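(* Let $B$ be a Polish metric space and let $\mathcal{F}_B$ be the set of isometry classes of compact $B$-fields. Then the Gromov-Hausdorff distance $d_{GH}$ is a metric on $\mathcal{F}_B$, and $(\mathcal{F}_B, d_{GH})$ is a Polish (complete and separable) metric space.
   Context: A Polish metric space is a complete separable metric space. Fix a Polish metric space $(B,d_B)$. A $B$-field is a triple $\mathcal{X}=(X,d_X,\pi_X)$, where $(X,d_X)$ is a nonempty Polish metric space and $\pi_X\colon X\to B$ is 1-Lipschitz; it is compact if $X$ is compact. An isometric embedding $\Phi\colon\mathcal{X}\Rightarrow\mathcal{Y}$ over $B$ is a distance-preserving map $\phi\colon X\to Y$ with $\pi_Y\circ\phi=\pi_X$; it is an isometry if $\phi$ is also bijective, and two $B$-fields are isometric if there is an isometry between them. The Gromov-Hausdorff distance between $B$-fields is $d_{GH}(\mathcal{X},\mathcal{Y}) := \inf_{\mathcal{Z},\Phi,\Psi} d_H^Z(\phi(X),\psi(Y))$, where the infimum is over all $B$-fields $\mathcal{Z}=(Z,d_Z,\pi_Z)$ and all isometric embeddings $\Phi\colon\mathcal{X}\Rightarrow\mathcal{Z}$, $\Psi\colon\mathcal{Y}\Rightarrow\mathcal{Z}$ over $B$ (with underlying maps $\phi,\psi$), and $d_H^Z$ is the Hausdorff distance in $Z$. *)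

(* Defs.v *)
From HB Require Import structures.
From mathcomp Require Import all_boot all_order all_algebra.
From mathcomp Require Import all_classical all_reals all_analysis.

Set Implicit Arguments.
Unset Strict Implicit.
Unset Printing Implicit Defensive.

Import Order.TTheory GRing.Theory Num.Theory.
Import numFieldNormedType.Exports.

Local Open Scope classical_set_scope.
Local Open Scope ring_scope.

(* The next four notions are stated for a bare distance function [d] on a type
   [T], not for a [metricType]: they apply both to [mdist] on a metric space
   and to a distance on the set of isometry classes, which lives in a universe
   too large to carry a [metricType]. *)
Definition is_metric (R : realType) (T : Type) (d : T -> T -> R) : Prop :=
  [/\ forall x y, 0 <= d x y,
      forall x y, d x y = 0 <-> x = y,
      forall x y, d x y = d y x
    & forall x y z, d x z <= d x y + d y z].

Definition complete_metric (R : realType) (T : Type) (d : T -> T -> R) : Prop :=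
  forall u : nat -> T,
    (forall e : R, 0 < e -> exists N : nat, forall m n : nat,
       (N <= m)%N -> (N <= n)%N -> d (u m) (u n) < e) ->
    exists l : T, d (u n) l @[n --> \oo] --> (0 : R).

(* [D] is a countable dense subset, [f] an injection of [D] into [nat]; written
   out because [countable] also forces a smaller universe. The empty space
   counts as separable. *)
Definition separable_metric (R : realType) (T : Type) (d : T -> T -> R) : Prop :=
  exists D : T -> Prop,
    (exists f : T -> nat, forall x y, D x -> D y -> f x = f y -> x = y) /\
    (forall (x : T) (e : R), 0 < e -> exists2 y, D y & d x y < e).

Definition polish_metric (R : realType) (T : Type) (d : T -> T -> R) : Prop :=
  [/\ is_metric d, complete_metric d & separable_metric d].

Record bfield (R : realType) (B : metricType R) := BField {
  bf_space :> metricType R;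
  bf_proj : bf_space -> B;
  bf_nonempty : [set: bf_space] !=set0;
  bf_polish : polish_metric (@mdist R bf_space);
  bf_lipschitz : forall x y : bf_space,
    mdist (bf_proj x) (bf_proj y) <= mdist x y }.

Record compact_bfield (R : realType) (B : metricType R) := CompactBField {
  cbf_field :> bfield B;
  cbf_compact : compact [set: cbf_field] }.

Definition isometric_embedding (R : realType) (B : metricType R)
    (X Y : bfield B) (phi : X -> Y) : Prop :=
  (forall x x' : X, mdist (phi x) (phi x') = mdist x x') /\
  (forall x : X, bf_proj (phi x) = bf_proj x).

Definition isometric (R : realType) (B : metricType R) (X Y : bfield B) : Prop :=
  exists phi : X -> Y, isometric_embedding phi /\ bijective phi.

(* Extended-real valued: it is [+oo] when one set is not within bounded
   distance of the other. *)
Definition hausdorff_dist (R : realType) (Z : metricType R) (A C : set Z) : \bar R :=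
  Order.max
    (ereal_sup [set ereal_inf [set (mdist a c)%:E | c in C] | a in A])
    (ereal_sup [set ereal_inf [set (mdist a c)%:E | a in A] | c in C]).

Definition gh_dist (R : realType) (B : metricType R) (X Y : bfield B) : \bar R :=
  ereal_inf [set r : \bar R |
    exists (Z : bfield B) (phi : X -> Z) (psi : Y -> Z),
      [/\ isometric_embedding phi, isometric_embedding psi
        & r = hausdorff_dist (range phi) (range psi)]].

Definition isometry_class (R : realType) (B : metricType R) :=
  {C : compact_bfield B -> Prop |
    exists X : compact_bfield B, C = (fun Y : compact_bfield B => isometric X Y)}.

Definition class_of (R : realType) (B : metricType R) (X : compact_bfield B) :
    isometry_class B :=
  exist _ (fun Y : compact_bfield B => isometric X Y) (ex_intro _ X erefl).

Definition class_repr (R : realType) (B : metricType R) (C : isometry_class B) :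
    compact_bfield B :=
  sval (cid (svalP C)).

Definition class_dist (R : realType) (B : metricType R) (C D : isometry_class B) : R :=
  fine (gh_dist (class_repr C) (class_repr D)).

(* Main.v *)
Require Import Defs.
From HB Require Import structures.
From mathcomp Require Import all_boot all_order all_algebra.
From mathcomp Require Import all_classical all_reals all_analysis.
From mathcomp Require Import lra.

Set Implicit Arguments.
Unset Strict Implicit.
Unset Printing Implicit Defensive.

Import Order.TTheory GRing.Theory Num.Theory.
Import numFieldNormedType.Exports.

Local Open Scope classical_set_scope.
Local Open Scope ring_scope.

(** The distance [gh_dist X Y] quantifies over all ambient fields; everything
    becomes easy once it is expressed by correspondences. A correspondence of
    size [r] between [X] and [Y] is a relation, total on both sides, that distorts
    distances by at most [2 * r] and relates only points whose projections to [B]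
    are at distance at most [r]. If [X] and [Y] sit in a common field at Hausdorff
    distance less than [r], the pairs at distance at most [r] form a correspondence
    of size [r] ([gh_dist_lt_correspondence]). Conversely a correspondence [rho] of
    size [r] defines a distance on the disjoint union, the one between [x] and [y]
    being the infimum of [mdist x x' + r + mdist y' y] over related pairs
    [(x', y')]; the bound on projections makes the common projection 1-Lipschitz,
    so that [X] and [Y] are within [r] of each other in a common field
    ([correspondence_gh_dist]). Hence, for compact fields, [gh_dist X Y] is the
    infimum of the sizes of correspondences. It is finite because compact spaces are
    bounded, and the triangle inequality is the composition of relations.

    Distance zero implies isometry ([gh_close_all_isometric]): choose functions
    [f_n : X -> Y] and [g_n : Y -> X] inside correspondences of size [2 ^ -n] and
    take their pointwise limits along a free ultrafilter on [nat], which exist by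
    compactness. The limits preserve distances and projections, and they are inverse
    to each other since [g_n] almost inverts [f_n].

    Completeness ([gh_halving_limit]): if consecutive terms of [X_n] are related by
    correspondences [rho_n] of size [2 ^ -n], the limit is the space of threads,
    that is of sequences [s_n] in [X_n] with [rho_n s_n s_(n+1)], with the
    pseudometric [lim mdist s_n t_n] and the projection [lim bf_proj s_n], which
    exists since [B] is complete. Threads are compact because the [rho_n] may be
    taken closed, so that the coordinatewise limit of threads along an ultrafilter
    is a thread, and because coordinate [n] determines the distance up to
    [4 * 2 ^ -n]. Identifying threads at distance zero ([quotient_bfield]) gives a
    compact field, and [s |-> s_n] is a correspondence of size [2 * 2 ^ -n].

    Separability ([gh_code]): a metric space is separable iff for every [e > 0]
    countably many labels can be attached to its points so that points with the
    same label are [e]-close. A compact field is labelled by a finite net, recording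
    the mutual distances rounded to multiples of [e] and labels of the projections
    in [B]; equal labels make the two nets correspond. *)

(** * Complete and separable metrics *)

Lemma mdist_is_metric (R : realType) (M : metricType R) : is_metric (@mdist R M).
Proof.
split=> [x y|x y|x y|x y z].
- exact: mdist_ge0.
- by split=> [/mdist_positivity|->]; rewrite ?mdistxx.
- exact: metric_sym.
- exact: metric_triangle.
Qed.

Lemma half_pow_gt0 (R : realType) n : 0 < (2^-1 : R) ^+ n.
Proof. by rewrite exprn_gt0// invr_gt0. Qed.

Lemma half_powS (R : realType) n : (2^-1 : R) ^+ n.+1 = 2^-1 ^+ n / 2.
Proof. by rewrite exprS mulrC. Qed.

Lemma half_pow_le (R : realType) m n : (n <= m)%N -> (2^-1 : R) ^+ m <= 2^-1 ^+ n.
Proof.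
by move=> nm; rewrite ler_wiXn2l// ?invr_ge0// invf_le1// ler1n.
Qed.

Lemma half_pow_lt (R : realType) (e : R) : 0 < e -> exists n, 2^-1 ^+ n < e.
Proof.
move=> e0; have h : `|(2^-1 : R)| < 1 by rewrite ger0_norm ?invr_ge0// invf_lt1// ltr1n.
have /cvgrPdist_lt/(_ e e0)[N _ /(_ N (leqnn _))] := cvg_expr h.
by rewrite sub0r normrN ger0_norm ?(ltW (half_pow_gt0 _ _))//; exists N.
Qed.

Lemma le_half_pow (R : realType) (K x y : R) : 0 < K ->
  (forall n, x <= y + K * 2^-1 ^+ n) -> x <= y.
Proof.
move=> K0 h; apply/ler_addgt0Pr => e e0.
have [n ne] := half_pow_lt (divr_gt0 e0 K0).
apply: (le_trans (h n)); rewrite lerD2l mulrC -ler_pdivlMr//; exact: ltW.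
Qed.

Lemma cvg_dist0P (R : realType) (f : nat -> R) : (forall n, 0 <= f n) ->
  f n @[n --> \oo] --> (0 : R) <->
  forall e, 0 < e -> exists N, forall n, (N <= n)%N -> f n < e.
Proof.
move=> f0; split=> [/cvgrPdist_lt h e /h[N _ hN]|h].
  by exists N => n /hN /=; rewrite sub0r normrN ger0_norm.
apply/cvgrPdist_lt => e /h[N hN]; exists N => // n /hN /=.
by rewrite sub0r normrN ger0_norm.
Qed.

(** A Cauchy sequence has a subsequence whose consecutive terms are at distance
    less than [2 ^ -n], and converges as soon as that subsequence does. *)
Lemma complete_metric_halving (R : realType) (T : Type) (d : T -> T -> R) (K : R) :
    is_metric d -> 0 < K ->
    (forall u : nat -> T, (forall n, d (u n) (u n.+1) < 2^-1 ^+ n) ->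
      exists l, forall n, d (u n) l <= K * 2^-1 ^+ n) ->
  complete_metric d.
Proof.
move=> [d0 _ _ dtri] K0 h u uC.
have [N hN] : {N : nat -> nat & forall k, forall m n : nat,
    (N k <= m)%N -> (N k <= n)%N -> d (u m) (u n) < 2^-1 ^+ k}.
  by apply: (@choice _ _ (fun k N => forall m n : nat,
    (N <= m)%N -> (N <= n)%N -> d (u m) (u n) < 2^-1 ^+ k)) => k;
    apply/uC/half_pow_gt0.
pose N' k := (\sum_(i < k.+1) N i)%N.
have NN' k : (N k <= N' k)%N by rewrite /N' big_ord_recr leq_addl.
have N'S k : (N' k <= N' k.+1)%N by rewrite /N' (big_ord_recr k.+1) leq_addr.
have [l hl] := h (u \o N') (fun k => hN _ _ _ (NN' k) (leq_trans (NN' k) (N'S k))).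
exists l; apply/cvg_dist0P => // e e0.
have e2 : 0 < e / 2 by lra.
have [k1 hk1] := half_pow_lt e2.
have [k2 hk2] := half_pow_lt (divr_gt0 e2 K0).
pose k := maxn k1 k2.
have kk1 : (2^-1 : R) ^+ k < e / 2.
  by apply: le_lt_trans hk1; apply: half_pow_le; rewrite leq_maxl.
have kk2 : K * (2^-1 : R) ^+ k < e / 2.
  rewrite mulrC -ltr_pdivlMr//; apply: le_lt_trans hk2.
  by apply: half_pow_le; rewrite leq_maxr.
exists (N' k) => n Nn.
have := hN k n (N' k) (leq_trans (NN' k) Nn) (NN' k).
by have := hl k; have := dtri (u n) (u (N' k)) l; rewrite /=; lra.
Qed.

(** The limit comes with the speed of convergence obtained by summing the
    geometric series of the steps. *)
Lemma complete_metric_geometric (R : realType) (T : Type) (d : T -> T -> R)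
    (K : R) (u : nat -> T) :
    is_metric d -> complete_metric d -> 0 < K ->
    (forall n, d (u n) (u n.+1) <= K * 2^-1 ^+ n) ->
  exists l, forall n, d (u n) l <= 2 * K * 2^-1 ^+ n.
Proof.
move=> [d0 deq dsym dtri] dC K0 hu.
(* Keeping the remainder [2^-1 ^+ (n + k)] makes the induction go through. *)
have dist_ub n k : d (u n) (u (n + k)%N) <= 2 * K * (2^-1 ^+ n - 2^-1 ^+ (n + k)).
  elim: k => [|k IH]; first by rewrite addn0 subrr mulr0 (deq _ _).2.
  rewrite addnS; have := dtri (u n) (u (n + k)%N) (u (n + k).+1).
  by have := hu (n + k)%N; rewrite half_powS; lra.
have dist_lt n m : (n <= m)%N -> d (u n) (u m) <= 2 * K * 2^-1 ^+ n.
  move=> nm; apply: le_trans (_ : 2 * K * (2^-1 ^+ n - 2^-1 ^+ m) <= _).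
    by rewrite -(subnKC nm).
  rewrite ler_wpM2l//; first by lra.
  by have := half_pow_gt0 R m; lra.
have [e e0|l] := dC u.
  have K4 : 0 < 4 * K by lra.
  have [N hN] := half_pow_lt (divr_gt0 e0 K4).
  have {}hN : 4 * K * 2^-1 ^+ N < e by rewrite mulrC -ltr_pdivlMr.
  exists N => m n Nm Nn; have := dtri (u m) (u N) (u n); rewrite (dsym (u m) (u N)).
  by have := dist_lt _ _ Nm; have := dist_lt _ _ Nn; lra.
move/cvg_dist0P => /(_ (fun n => d0 _ _)) hl.
exists l => n; apply/ler_addgt0Pr => e e0.
have [N hN] := hl e e0.
have := hN (maxn n N) (leq_maxr _ _).
have := dist_lt n (maxn n N) (leq_maxl _ _).
by have := dtri (u n) (u (maxn n N)) l; lra.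
Qed.

Lemma complete_metric_real (R : realType) : complete_metric (fun x y : R => `|x - y|).
Proof.
move=> u uC.
have : cvgn u.
  apply/cauchy_cvgP/cauchy_exP => e e0; have [N hN] := uC e e0.
  by exists (u N); exists N => // n Nn; exact: hN.
move=> /cvg_ex[l ul]; exists l; apply/cvg_dist0P => // e e0.
by have /cvgrPdist_lt/(_ e e0)[N _ hN] := ul; exists N => n /hN /=; rewrite distrC.
Qed.

(** With its converse below, this turns separability into the existence of
    countable labellings, which are easy to transport: no dense subset has to be
    exhibited. The label of a point is that of a nearby point of the dense set. *)
Lemma separable_metric_code (R : realType) (T : Type) (d : T -> T -> R) :
    is_metric d -> separable_metric d ->
  forall e, 0 < e -> exists h : T -> nat, forall x y, h x = h y -> d x y < e.
Proof.
move=> [_ _ dsym dtri] [D [[f fI] dD]] e e0.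
have e2 : 0 < e / 2 by lra.
have [g hg] : {g : T -> T & forall x, D (g x) /\ d x (g x) < e / 2}.
  by apply: (@choice _ _ (fun x y => D y /\ d x y < e / 2)) => x;
     have [y] := dD x _ e2; exists y.
exists (f \o g) => x y fxy; have [Dx xg] := hg x; have [Dy yg] := hg y.
have gxy := fI _ _ Dx Dy fxy; rewrite gxy in xg.
by have := dtri x (g y) y; rewrite (dsym (g y) y); lra.
Qed.

(** The dense set consists of one representative for each label and each scale
    [2 ^ -k]; it is countable since it is indexed by pairs of natural numbers. *)
Lemma code_separable_metric (R : realType) (T : Type) (d : T -> T -> R) :
    (forall e, 0 < e -> exists h : T -> nat, forall x y, h x = h y -> d x y < e) ->
  separable_metric d.
Proof.
move=> hd.
have [h hh] : {h : nat -> T -> nat &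
    forall k x y, h k x = h k y -> d x y < 2^-1 ^+ k}.
  by apply: (@choice _ _ (fun k h => forall x y, h x = h y -> d x y < 2^-1 ^+ k))
    => k; apply/hd/half_pow_gt0.
(* [rep c] depends on the label only, whichever point carries it. *)
pose rep (c : nat * nat) : option T :=
  if pselect (exists y, h c.1 y = c.2) is left H then Some (sval (cid H)) else None.
have repP c y : h c.1 y = c.2 -> exists2 x, rep c = Some x & h c.1 x = c.2.
  move=> hy; rewrite /rep; case: pselect => [H|[]]; last by exists y.
  by exists (sval (cid H)) => //; exact: svalP (cid H).
pose D x := exists c, rep c = Some x.
exists D; split.
  pose f x := if pselect (D x) is left H then pickle (sval (cid H)) else 0%N.
  exists f => x y Dx Dy; rewrite /f.
  case: pselect => // Hx; case: pselect => // Hy.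
  move/(pcan_inj pickleK) => e; have := svalP (cid Hy); rewrite -e.
  by have -> := svalP (cid Hx) => -[].
move=> x e e0; have [k hk] := half_pow_lt e0.
have [y ry hy] := repP (k, h k x) x erefl.
by exists y; [exists (k, h k x)|apply: lt_trans hk; apply/hh/esym].
Qed.

(** * Compactness and quotients of pseudometrics *)

(** Compactness of a pseudometric that has no topological structure attached to
    it: limits along ultrafilters exist. The ultrafilter lives on an index type
    [I], so that ultrafilters need not be pushed forward along maps. *)
Definition ultracompact (R : realType) (T : Type) (d : T -> T -> R) : Prop :=
  forall (I : Type) (U : set_system I), UltraFilter U ->
  forall g : I -> T, exists l, forall e, 0 < e -> U [set i | d l (g i) < e].

Lemma compact_ultracompact (R : realType) (M : metricType R) :
  compact [set: M] -> ultracompact (@mdist R M).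
Proof.
move=> Mc I U UU g.
have [|l [_ hl]] := Mc (g @ U) _; first exact: filterT.
exists l => e e0.
have [//|Un] := in_ultra_setVsetC [set i | mdist l (g i) < e] UU.
have [||y [/= yn]] := hl [set y | ~ mdist l y < e] (ball l e).
- exact: Un.
- exact: nbhsx_ballx.
- by rewrite ballEmdist.
Qed.

Lemma ultracompact_compact (R : realType) (M : metricType R) :
  ultracompact (@mdist R M) -> compact [set: M].
Proof.
move=> Mu; rewrite compact_ultra => F FU _; have [l hl] := Mu _ F FU id.
exists l; split=> //=; apply/metricType_numDomainType.fcvgrPdist_lt => e e0.
exact: hl.
Qed.

(** Otherwise the sets of points far from a given finite list form a proper
    filter, and a cluster point [l] of it would be far from itself. *)
Lemma compact_net (R : realType) (M : metricType R) : compact [set: M] ->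
  forall e : R, 0 < e -> exists s : seq M, forall x, exists2 y, y \in s & mdist x y < e.
Proof.
move=> Mc e e0; apply: contrapT => /forallNP noNet.
have far (s : seq M) : exists x, forall y, y \in s -> e <= mdist x y.
  have /existsNP[x hx] := noNet s; exists x => y ys; rewrite leNgt.
  by apply/negP => xy; apply: hx; exists y.
pose F := filter_from [set: seq M] (fun s => [set x | forall y, y \in s -> e <= mdist x y]).
have FF : ProperFilter F.
  apply: filter_from_proper => [|s _]; last exact: far.
  apply: filter_from_filter; first by exists [::].
  move=> s t _ _; exists (s ++ t) => // x /= hx.
  by split=> y ys; apply: hx; rewrite mem_cat ys ?orbT.
have [|l [_ hl]] := Mc F FF; first exact: filterT.
have [||y [/= hy]] := hl [set x | e <= mdist x l] (ball l e).
- by exists [:: l] => // x; apply; rewrite mem_head.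
- exact: nbhsx_ballx.
- by rewrite ballEmdist/= metric_sym ltNge hy.
Qed.

Lemma compact_bounded_dist (R : realType) (M : metricType R) :
  compact [set: M] -> [set: M] !=set0 -> exists K : R, forall x y : M, mdist x y <= K.
Proof.
move=> Mc [x0 _]; have [s hs] := compact_net Mc (@ltr01 R).
have bd x : mdist x x0 <= 1 + \sum_(y <- s) mdist y x0.
  have [y ys xy] := hs x; apply: le_trans (metric_triangle x y x0) _.
  apply: lerD; first exact: ltW.
  by rewrite (big_rem y)//= lerDl sumr_ge0// => *; exact: mdist_ge0.
exists ((1 + \sum_(y <- s) mdist y x0) + (1 + \sum_(y <- s) mdist y x0)) => x y.
apply: le_trans (metric_triangle x x0 y) _; rewrite (metric_sym x0).
exact: lerD.
Qed.

(** A Cauchy sequence converges to its limit along any ultrafilter finer than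
    the filter of cofinite sets; points are labelled by a nearby point of a finite
    net. *)
Lemma compact_polish (R : realType) (M : metricType R) :
  compact [set: M] -> polish_metric (@mdist R M).
Proof.
move=> Mc; split; first exact: mdist_is_metric.
- move=> u uC.
  have [U [UU Uoo]] := ultraFilterLemma (eventually_filter).
  have [l hl] := compact_ultracompact Mc UU u.
  exists l; apply/cvg_dist0P => [n|e e0]; first exact: mdist_ge0.
  have e2 : 0 < e / 2 by lra.
  have [N hN] := uC _ e2; exists N => n Nn.
  have UN : U [set i | (N <= i)%N] by apply: Uoo; exists N.
  have [i [/= li Ni]] := filter_ex (filterI (hl _ e2) UN).
  have := hN n i Nn Ni; have := metric_triangle (u n) (u i) l.
  by rewrite (metric_sym (u i) l); lra.
- apply: code_separable_metric => e e0; have e2 : 0 < e / 2 by lra.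
  have [s hs] := compact_net Mc e2.
  have [g hg] : {g : M -> M & forall x, g x \in s /\ mdist x (g x) < e / 2}.
    by apply: (@choice _ _ (fun x y => y \in s /\ mdist x y < e / 2)) => x;
       have [y] := hs x; exists y.
  exists (fun x => index (g x) s) => x y exy.
  have [xs xg] := hg x; have [ys yg] := hg y.
  have gxy : g x = g y by rewrite -(nth_index x xs) exy nth_index.
  rewrite gxy in xg.
  by have := metric_triangle x (g y) y; rewrite (metric_sym (g y) y); lra.
Qed.

(** The points of the quotient are the classes [fun y => D x y = 0], viewed as
    predicates, so that equality of classes is extensional equality. *)
Lemma quotient_metric (R : realType) (T : Type) (D : T -> T -> R) :
    (forall x, D x x = 0) -> (forall x y, D x y = D y x) ->
    (forall x y z, D x z <= D x y + D y z) ->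
  exists (M : metricType R) (p : T -> M) (s : M -> T),
    (forall z, p (s z) = z) /\ (forall x y, mdist (p x) (p y) = D x y).
Proof.
move=> Dxx Dsym Dtri.
have D_ge0 x y : 0 <= D x y.
  by have := Dtri x y x; rewrite Dxx (Dsym y x); lra.
have D0l x y z : D x y = 0 -> D x z = D y z.
  move=> xy; have := Dtri x y z; have := Dtri y x z; rewrite (Dsym y x); lra.
pose Q := {A : T -> Prop | exists x, A = fun y => D x y = 0}.
pose p (x : T) : Q := exist _ (fun y => D x y = 0) (ex_intro _ x erefl).
pose s (z : Q) : T := sval (cid (svalP z)).
have ps z : p (s z) = z.
  by case: z => A HA; apply: eq_exist; rewrite /s /=; case: cid => x.
have sp x : D (s (p x)) x = 0.
  have : D x x = 0 by [].
  have := ps (p x) => /(congr1 sval) /= e.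
  by rewrite -[X in X -> _]/((fun y => D x y = 0) x) -e.
pose dQ (z w : Q) := D (s z) (s w).
have dQp x y : dQ (p x) (p y) = D x y.
  by rewrite /dQ (D0l _ _ _ (sp x)) Dsym (D0l _ _ _ (sp y)) Dsym.
pose QC : choiceType := HB.pack Q (gen_eqMixin Q) (gen_choiceMixin Q).
have dQ0 (z : QC) : dQ z z = 0 by exact: Dxx.
have dQpos (z w : QC) : dQ z w = 0 -> z = w.
  move=> zw; rewrite -(ps z) -(ps w); apply: eq_exist; apply/funext => y.
  by rewrite (D0l _ _ _ zw).
have dQsym (z w : QC) : dQ z w = dQ w z by exact: Dsym.
have dQtri (y x z : QC) : dQ x z <= dQ x y + dQ y z by exact: Dtri.
pose M : metricType R := HB.pack Q (gen_eqMixin Q) (gen_choiceMixin Q)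
   (isMetric.Build R QC dQ0 dQpos dQsym dQtri).
by exists M, p, s.
Qed.

(** All the fields built here, disjoint unions and inverse limits alike, arise
    as pseudometrics, from which this lemma produces genuine compact fields. *)
Lemma quotient_bfield (R : realType) (B : metricType R) (T : Type)
    (D : T -> T -> R) (f : T -> B) :
    (forall x, D x x = 0) -> (forall x y, D x y = D y x) ->
    (forall x y z, D x z <= D x y + D y z) ->
    (exists x : T, True) -> ultracompact D ->
    (forall x y, mdist (f x) (f y) <= D x y) ->
  exists (Z : compact_bfield B) (p : T -> Z),
    [/\ forall z, exists x, p x = z, forall x y, mdist (p x) (p y) = D x y
      & forall x, bf_proj (p x) = f x].
Proof.
move=> Dxx Dsym Dtri [x0 _] Dc fD.
have [M [p [s [ps pD]]]] := quotient_metric Dxx Dsym Dtri.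
have Mc : compact [set: M].
  apply: ultracompact_compact => I U UU g.
  have [l hl] := Dc I U UU (s \o g); exists (p l) => e e0.
  by apply: filterS (hl e e0) => i /=; rewrite -[g i]ps pD ps.
have Lip (x y : M) : mdist (f (s x)) (f (s y)) <= mdist x y.
  by rewrite -[in leRHS](ps x) -[in leRHS](ps y) pD.
have M0 : [set: M] !=set0 by exists (p x0).
exists (@CompactBField _ _ (BField M0 (compact_polish Mc) Lip) Mc), p.
split=> [z|//|x /=]; first by exists (s z).
apply/mdist_positivity/le_anti; rewrite mdist_ge0 andbT.
by apply: le_trans (fD _ _) _; rewrite -pD ps mdistxx.
Qed.

(** * Correspondences and the Gromov-Hausdorff distance *)

Definition correspondence (R : realType) (B : metricType R) (r : R)
    (X Y : bfield B) (rho : X -> Y -> Prop) : Prop :=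
  [/\ forall x, exists y, rho x y,
      forall y, exists x, rho x y,
      forall x x' y y', rho x y -> rho x' y' ->
        mdist x x' <= mdist y y' + 2 * r /\ mdist y y' <= mdist x x' + 2 * r
    & forall x y, rho x y -> mdist (bf_proj x) (bf_proj y) <= r].

Definition gh_close (R : realType) (B : metricType R) (r : R) (X Y : bfield B) :=
  exists rho : X -> Y -> Prop, correspondence r rho.

Lemma gh_close_sym (R : realType) (B : metricType R) (r : R) (X Y : bfield B) :
  gh_close r X Y -> gh_close r Y X.
Proof.
move=> [rho [tot surj dis disp]]; exists (fun y x => rho x y); split=> //.
- by move=> y y' x x' xy xy'; have [] := dis _ _ _ _ xy xy'.
- by move=> y x xy; rewrite metric_sym; exact: disp.
Qed.

Lemma gh_close_trans (R : realType) (B : metricType R) (r s : R)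
    (X Y Z : bfield B) :
  gh_close r X Y -> gh_close s Y Z -> gh_close (r + s) X Z.
Proof.
move=> [rho [tot surj dis disp]] [tau [tot' surj' dis' disp']].
exists (fun x z => exists2 y, rho x y & tau y z); split.
- by move=> x; have [y xy] := tot x; have [z yz] := tot' y; exists z, y.
- by move=> z; have [y yz] := surj' z; have [x xy] := surj y; exists x, y.
- move=> x x' z z' [y xy yz] [y' xy' yz'].
  by have := dis _ _ _ _ xy xy'; have := dis' _ _ _ _ yz yz'; lra.
- move=> x z [y xy yz]; have := metric_triangle (bf_proj x) (bf_proj y) (bf_proj z).
  by have := disp _ _ xy; have := disp' _ _ yz; lra.
Qed.

Lemma gh_close_ge0 (R : realType) (B : metricType R) (r : R) (X Y : bfield B) :
  gh_close r X Y -> 0 <= r.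
Proof.
have [x0 _] := bf_nonempty X; move=> [rho [tot _ _ disp]].
have [y xy] := tot x0; exact: le_trans (mdist_ge0 _ _) (disp _ _ xy).
Qed.

Lemma gh_close_isometric (R : realType) (B : metricType R) (X Y : bfield B) :
  isometric X Y -> gh_close 0 X Y.
Proof.
move=> [phi [[phid phip] [psi K1 K2]]]; exists (fun x y => phi x = y); split.
- by move=> x; exists (phi x).
- by move=> y; exists (psi y).
- by move=> x x' _ _ <- <-; rewrite phid mulr0 addr0.
- by move=> x _ <-; rewrite phip mdistxx.
Qed.

Lemma compact_gh_close (R : realType) (B : metricType R) (X Y : compact_bfield B) :
  exists r, gh_close r X Y.
Proof.
have [K hK] := compact_bounded_dist (@cbf_compact _ _ X) (bf_nonempty X).
have [L hL] := compact_bounded_dist (@cbf_compact _ _ Y) (bf_nonempty Y).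
have [x0 _] := bf_nonempty X; have [y0 _] := bf_nonempty Y.
pose c := mdist (bf_proj x0) (bf_proj y0).
have K0 := le_trans (mdist_ge0 _ _) (hK x0 x0).
have L0 := le_trans (mdist_ge0 _ _) (hL y0 y0).
have c0 : 0 <= c by exact: mdist_ge0.
exists (K + L + c), (fun _ _ => True); split.
- by move=> _; exists y0.
- by move=> _; exists x0.
- move=> x x' y y' _ _; have := hK x x'; have := hL y y'.
  by have := mdist_ge0 x x'; have := mdist_ge0 y y'; lra.
- move=> x y _; have := hK x x0; have := hL y0 y.
  have := bf_lipschitz x x0; have := bf_lipschitz y0 y.
  have := metric_triangle (bf_proj x) (bf_proj x0) (bf_proj y).
  have := metric_triangle (bf_proj x0) (bf_proj y0) (bf_proj y).
  by rewrite -/c; lra.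
Qed.

(** In a common field, [x] and [y] are related when their images are at distance
    at most [r]. The large inequality makes the relation closed in the product, which
    is what compactness of the space of threads rests on. *)
Lemma gh_dist_lt_correspondence (R : realType) (B : metricType R)
    (r : R) (X Y : bfield B) : (gh_dist X Y < r%:E)%E ->
  exists2 rho : X -> Y -> Prop, correspondence r rho &
    forall x y, (forall e, 0 < e ->
      exists x' y', [/\ rho x' y', mdist x x' < e & mdist y y' < e]) -> rho x y.
Proof.
move=> /ereal_inf_lt[_ [Z [phi [psi [[phid phip] [psid psip] ->]]]]].
rewrite /hausdorff_dist gt_max => /andP[h1 h2].
exists (fun x y => mdist (phi x) (psi y) <= r).
  split.
  - move=> x; have /ereal_inf_lt[_ [_ [y _ <-] <-]] :
        (ereal_inf [set (mdist (phi x) c)%:E | c in range psi] < r%:E)%E.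
      by apply: le_lt_trans h1; apply: ereal_sup_ubound; exists (phi x).
    by rewrite lte_fin => /ltW xy; exists y.
  - move=> y; have /ereal_inf_lt[_ [_ [x _ <-] <-]] :
        (ereal_inf [set (mdist a (psi y))%:E | a in range phi] < r%:E)%E.
      by apply: le_lt_trans h2; apply: ereal_sup_ubound; exists (psi y).
    by rewrite lte_fin => /ltW xy; exists x.
  - move=> x x' y y' xy xy'; rewrite -(phid x) -(psid y).
    have := metric_triangle (phi x) (psi y) (phi x').
    have := metric_triangle (psi y) (psi y') (phi x').
    have := metric_triangle (psi y) (phi x) (psi y').
    have := metric_triangle (phi x) (phi x') (psi y').
    by rewrite (metric_sym (psi y') (phi x')) (metric_sym (psi y) (phi x)); lra.
  - by move=> x y xy; rewrite -phip -psip; apply: le_trans xy; exact: bf_lipschitz.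
move=> x y cl; apply/ler_addgt0Pr => e e0; have e2 : 0 < e / 2 by lra.
have [x' [y' [xy' xx' yy']]] := cl _ e2.
have := metric_triangle (phi x) (phi x') (psi y).
have := metric_triangle (phi x') (psi y') (psi y).
by rewrite (metric_sym (psi y')) !phid !psid; lra.
Qed.

(** A negative value would give a correspondence of negative size. *)
Lemma gh_dist_ge0 (R : realType) (B : metricType R) (X Y : bfield B) :
  (0 <= gh_dist X Y)%E.
Proof.
rewrite leNgt; apply/negP => gneg.
have [r rneg gr] : exists2 r, r < 0 & (gh_dist X Y < r%:E)%E.
  move: gneg; case: (gh_dist X Y) => [g| |] //; last first.
    by exists (-1); rewrite ?ltNyr// ltrN10.
  by rewrite lte_fin => g0; exists (g / 2); rewrite ?lte_fin; lra.
have [rho rhoP _] := gh_dist_lt_correspondence gr.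
by have := gh_close_ge0 (ex_intro _ rho rhoP); lra.
Qed.

Section Gluing.
Variables (R : realType) (B : metricType R) (r : R) (X Y : compact_bfield B).
Variables (rho : X -> Y -> Prop) (rhoP : correspondence r rho).

(** The length of the shortest path from [x] to [y] that crosses from [X] to [Y]
    along a related pair, each crossing costing [r]. *)
Definition cross_dist (x : X) (y : Y) : R :=
  inf [set v | exists x' y', rho x' y' /\ v = mdist x x' + r + mdist y' y].

Definition glue_dist (s t : X + Y) : R :=
  match s, t with
  | inl x, inl x' => mdist x x'
  | inl x, inr y => cross_dist x y
  | inr y, inl x => cross_dist x y
  | inr y, inr y' => mdist y y'
  end.

Let r_ge0 : 0 <= r. Proof. exact: gh_close_ge0 (ex_intro _ rho rhoP). Qed.

Lemma cross_dist_le x y x' y' : rho x' y' ->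
  cross_dist x y <= mdist x x' + r + mdist y' y.
Proof.
move=> xy'; apply: ge_inf; last by exists x', y'.
exists 0 => _ [a [b [_ ->]]].
by have := mdist_ge0 x a; have := mdist_ge0 b y; have := r_ge0; lra.
Qed.

Lemma cross_dist_near x y e : 0 < e ->
  exists x' y', rho x' y' /\ mdist x x' + r + mdist y' y < cross_dist x y + e.
Proof.
move=> e0; have [||_ [x' [y' [xy' ->]]] lt] :=
  @inf_lt _ [set v | exists x' y', rho x' y' /\ v = mdist x x' + r + mdist y' y]
    (cross_dist x y + e).
- by have [tot _ _ _] := rhoP; have [y' xy'] := tot x; eexists; exists x, y'.
- by rewrite ltrDl.
- by exists x', y'.
Qed.

Lemma cross_dist_triangle_l x x' y :
  cross_dist x y <= mdist x x' + cross_dist x' y.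
Proof.
apply/ler_addgt0Pr => e e0; have [a [b [ab lt]]] := cross_dist_near x' y e0.
by have := cross_dist_le x y ab; have := metric_triangle x x' a; lra.
Qed.

Lemma cross_dist_triangle_r x y y' :
  cross_dist x y <= cross_dist x y' + mdist y' y.
Proof.
apply/ler_addgt0Pr => e e0; have [a [b [ab lt]]] := cross_dist_near x y' e0.
by have := cross_dist_le x y ab; have := metric_triangle b y' y; lra.
Qed.

(** Going to [Y] and back is no shortcut: it costs [2 * r] in crossings, which
    pays for the distortion of [rho]. *)
Lemma cross_dist_via_r x x' y : mdist x x' <= cross_dist x y + cross_dist x' y.
Proof.
apply/ler_addgt0Pr => e e0; have e2 : 0 < e / 2 by lra.
have [_ _ dis _] := rhoP.
have [a [b [ab lt]]] := cross_dist_near x y e2.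
have [a' [b' [ab' lt']]] := cross_dist_near x' y e2.
have := dis _ _ _ _ ab ab'; have := metric_triangle x a x'.
have := metric_triangle a a' x'; have := metric_triangle b y b'.
by rewrite (metric_sym a' x') (metric_sym y b'); lra.
Qed.

Lemma cross_dist_via_l x y y' : mdist y y' <= cross_dist x y + cross_dist x y'.
Proof.
apply/ler_addgt0Pr => e e0; have e2 : 0 < e / 2 by lra.
have [_ _ dis _] := rhoP.
have [a [b [ab lt]]] := cross_dist_near x y e2.
have [a' [b' [ab' lt']]] := cross_dist_near x y' e2.
have := dis _ _ _ _ ab ab'; have := metric_triangle y b y'.
have := metric_triangle b b' y'; have := metric_triangle a x a'.
by rewrite (metric_sym y b) (metric_sym a x); lra.
Qed.

Lemma cross_dist_proj x y : mdist (bf_proj x) (bf_proj y) <= cross_dist x y.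
Proof.
apply/ler_addgt0Pr => e e0; have [_ _ _ disp] := rhoP.
have [a [b [ab lt]]] := cross_dist_near x y e0.
have := disp _ _ ab; have := bf_lipschitz x a; have := bf_lipschitz b y.
have := metric_triangle (bf_proj x) (bf_proj a) (bf_proj y).
by have := metric_triangle (bf_proj a) (bf_proj b) (bf_proj y); lra.
Qed.

Lemma glue_dist_sym s t : glue_dist s t = glue_dist t s.
Proof. by case: s t => [x|y] [x'|y'] //=; exact: metric_sym. Qed.

Lemma glue_dist_triangle s t u : glue_dist s u <= glue_dist s t + glue_dist t u.
Proof.
case: s t u => [x|y] [x'|y'] [x''|y''] /=.
- exact: metric_triangle.
- exact: cross_dist_triangle_l.
- exact: cross_dist_via_r.
- exact: cross_dist_triangle_r.
- by rewrite addrC metric_sym; exact: cross_dist_triangle_l.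
- exact: cross_dist_via_l.
- by rewrite addrC metric_sym; exact: cross_dist_triangle_r.
- exact: metric_triangle.
Qed.

(** An ultrafilter on the disjoint union lives on one of the two sides. *)
Lemma glue_dist_ultracompact : ultracompact glue_dist.
Proof.
move=> I U UU g.
have [x0 _] := bf_nonempty X; have [y0 _] := bf_nonempty Y.
have [Ul|Ur] := in_ultra_setVsetC [set i | exists x, g i = inl x] UU.
- have [l hl] := compact_ultracompact (@cbf_compact _ _ X) UU
    (fun i => if g i is inl x then x else x0).
  exists (inl l) => e e0.
  by apply: filterS (filterI Ul (hl e e0)) => i /= [[x ->]].
- have [l hl] := compact_ultracompact (@cbf_compact _ _ Y) UU
    (fun i => if g i is inr y then y else y0).
  exists (inr l) => e e0; apply: filterS (filterI Ur (hl e e0)) => i /= [].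
  by case: (g i) => [x []|//]; exists x.
Qed.

(** When [r = 0], related points are at distance zero in the glued space, hence
    the passage to the quotient. *)
Lemma correspondence_gh_dist : (gh_dist X Y <= r%:E)%E.
Proof.
have [x0 _] := bf_nonempty X; have [tot surj _ _] := rhoP.
pose proj (s : X + Y) := match s with inl x => bf_proj x | inr y => bf_proj y end.
have [|||Z [p [_ pd pp]]] :=
  quotient_bfield (f := proj) _ glue_dist_sym glue_dist_triangle _ glue_dist_ultracompact.
- by case=> z /=; rewrite mdistxx.
- by exists (inl x0).
- case=> [x|y] [x'|y'] /=; [exact: bf_lipschitz|exact: cross_dist_proj| |exact: bf_lipschitz].
  by rewrite metric_sym; exact: cross_dist_proj.
have close x y : rho x y -> mdist (p (inl x)) (p (inr y)) <= r.
  move=> xy; rewrite pd; apply: le_trans (cross_dist_le x y xy) _.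
  by rewrite !mdistxx add0r addr0.
apply: le_trans (_ : hausdorff_dist (range (p \o inl)) (range (p \o inr)) <= _)%E.
  apply: ereal_inf_lbound; exists Z, (p \o inl), (p \o inr); split=> //; split.
  - by move=> x x'; rewrite /= pd.
  - by move=> x; rewrite /= pp.
  - by move=> x x'; rewrite /= pd.
  - by move=> x; rewrite /= pp.
rewrite /hausdorff_dist ge_max; apply/andP; split; apply: ge_ereal_sup => _ [_ [z _ <-] <-].
- have [y xy] := tot z; apply: ge_ereal_inf.
  by exists (mdist (p (inl z)) (p (inr y)))%:E; [exists (p (inr y))|rewrite lee_fin close].
- have [x xy] := surj z; apply: ge_ereal_inf.
  by exists (mdist (p (inl x)) (p (inr z)))%:E; [exists (p (inl x))|rewrite lee_fin close].
Qed.

End Gluing.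

Lemma gh_dist_fin_num (R : realType) (B : metricType R) (X Y : compact_bfield B) :
  gh_dist X Y \is a fin_num.
Proof.
have [r [rho rhoP]] := compact_gh_close X Y.
rewrite ge0_fin_numE; last exact: gh_dist_ge0.
exact: le_lt_trans (correspondence_gh_dist rhoP) (ltry _).
Qed.

Lemma gh_dist_le (R : realType) (B : metricType R) (X Y : compact_bfield B) r :
  gh_close r X Y -> fine (gh_dist X Y) <= r.
Proof.
move=> [rho rhoP]; rewrite -lee_fin fineK ?gh_dist_fin_num//.
exact: correspondence_gh_dist rhoP.
Qed.

Lemma gh_dist_lt (R : realType) (B : metricType R) (X Y : compact_bfield B) r :
  fine (gh_dist X Y) < r -> gh_close r X Y.
Proof.
rewrite -lte_fin fineK ?gh_dist_fin_num// => /gh_dist_lt_correspondence[rho rhoP _].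
by exists rho.
Qed.

Lemma gh_dist_sym (R : realType) (B : metricType R) (X Y : compact_bfield B) :
  fine (gh_dist X Y) = fine (gh_dist Y X).
Proof.
apply/le_anti/andP; split; apply/ler_addgt0Pr => e e0;
  by apply/gh_dist_le/gh_close_sym/gh_dist_lt; rewrite ltrDl.
Qed.

Lemma gh_dist_triangle (R : realType) (B : metricType R)
    (X Y Z : compact_bfield B) :
  fine (gh_dist X Z) <= fine (gh_dist X Y) + fine (gh_dist Y Z).
Proof.
apply/ler_addgt0Pr => e e0; have e2 : 0 < e / 2 by lra.
have -> : fine (gh_dist X Y) + fine (gh_dist Y Z) + e =
  (fine (gh_dist X Y) + e / 2) + (fine (gh_dist Y Z) + e / 2) by lra.
apply: gh_dist_le; apply: (@gh_close_trans _ _ _ _ X Y Z);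
  by apply: gh_dist_lt; rewrite ltrDl.
Qed.

Lemma gh_dist_isometric (R : realType) (B : metricType R) (X Y : compact_bfield B) :
  isometric X Y -> fine (gh_dist X Y) = 0.
Proof.
move=> /gh_close_isometric/gh_dist_le XY; apply/le_anti; rewrite XY /=.
exact/fine_ge0/gh_dist_ge0.
Qed.

Lemma isometric_gh_dist (R : realType) (B : metricType R)
    (X X' Y Y' : compact_bfield B) : isometric X X' -> isometric Y Y' ->
  fine (gh_dist X Y) = fine (gh_dist X' Y').
Proof.
move=> /gh_dist_isometric XX /gh_dist_isometric YY.
have := gh_dist_triangle X X' Y; have := gh_dist_triangle X' Y' Y.
have := gh_dist_triangle X' X Y'; have := gh_dist_triangle X Y Y'.
by rewrite (gh_dist_sym Y' Y) (gh_dist_sym X' X); lra.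
Qed.

(** * Fields at distance zero *)

Lemma isometric_refl (R : realType) (B : metricType R) (X : bfield B) : isometric X X.
Proof. by exists id; split; [split|exists id]. Qed.

Lemma isometric_sym (R : realType) (B : metricType R) (X Y : bfield B) :
  isometric X Y -> isometric Y X.
Proof.
move=> [phi [[phid phip] [psi K1 K2]]]; exists psi; split; last by exists phi.
by split=> [y y'|y]; rewrite -?phid -?phip ?K2.
Qed.

Lemma isometric_trans (R : realType) (B : metricType R) (X Y Z : bfield B) :
  isometric X Y -> isometric Y Z -> isometric X Z.
Proof.
move=> [phi [[phid phip] phib]] [psi [[psid psip] psib]].
exists (psi \o phi); split; last exact: bij_comp.
by split=> [x x'|x] /=; rewrite ?psid ?phid ?psip ?phip.
Qed.

(** Limits along an ultrafilter provide both an isometric embedding and its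
    inverse, so that the fact that isometric self-embeddings of compact spaces are
    onto is not called upon. *)
Lemma gh_close_all_isometric (R : realType) (B : metricType R)
    (X Y : compact_bfield B) :
  (forall e, 0 < e -> gh_close e X Y) -> isometric X Y.
Proof.
move=> XY.
have [U [UU Uoo]] := ultraFilterLemma eventually_filter.
have small (e : R) : 0 < e -> U [set n | 2^-1 ^+ n < e].
  move=> e0; apply: Uoo; have [N hN] := half_pow_lt e0; exists N => // n Nn /=.
  exact: le_lt_trans (half_pow_le _ Nn) hN.
have rhoX n := cid (XY _ (half_pow_gt0 R n)).
pose rho n := sval (rhoX n).
have dis n x x' y y' : rho n x y -> rho n x' y' ->
    mdist x x' <= mdist y y' + 2 * 2^-1 ^+ n /\ mdist y y' <= mdist x x' + 2 * 2^-1 ^+ n.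
  by have [_ _ + _] := svalP (rhoX n); apply.
have disp n x y : rho n x y -> mdist (bf_proj x) (bf_proj y) <= 2^-1 ^+ n.
  by have [_ _ _ +] := svalP (rhoX n); apply.
have /choice[f hf] n : exists f, forall x, rho n x (f x).
  by have [/choice[f hf] _ _ _] := svalP (rhoX n); exists f.
have /choice[g hg] n : exists g, forall y, rho n (g y) y.
  by have [_ /choice[g hg] _ _] := svalP (rhoX n); exists g.
have /choice[phi hphi] x := compact_ultracompact (@cbf_compact _ _ Y) UU (fun n => f n x).
have /choice[psi hpsi] y := compact_ultracompact (@cbf_compact _ _ X) UU (fun n => g n y).
exists phi; split; first split.
- have phi_dist x x' e : 0 < e -> mdist (phi x) (phi x') <= mdist x x' + e /\
      mdist x x' <= mdist (phi x) (phi x') + e.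
    move=> e0; have e4 : 0 < e / 4 by lra.
    have [n [[/= xn x'n] sn]] :=
      filter_ex (filterI (filterI (hphi x _ e4) (hphi x' _ e4)) (small _ e4)).
    have := dis n _ _ _ _ (hf n x) (hf n x').
    have := metric_triangle (phi x) (f n x) (phi x').
    have := metric_triangle (f n x) (f n x') (phi x').
    have := metric_triangle (f n x) (phi x) (f n x').
    have := metric_triangle (phi x) (phi x') (f n x').
    by rewrite (metric_sym (f n x') (phi x')) (metric_sym (f n x) (phi x)) /=; lra.
  by move=> x x'; apply/le_anti/andP; split; apply/ler_addgt0Pr => e /(phi_dist x x')[].
- move=> x; apply/mdist_positivity/le_anti; rewrite mdist_ge0 andbT.
  apply/ler_addgt0Pr => e e0; rewrite add0r; have e2 : 0 < e / 2 by lra.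
  have [n [/= xn sn]] := filter_ex (filterI (hphi x _ e2) (small _ e2)).
  have := disp n _ _ (hf n x); have := bf_lipschitz (phi x) (f n x).
  have := metric_triangle (bf_proj (phi x)) (bf_proj (f n x)) (bf_proj x).
  by rewrite (metric_sym (bf_proj (f n x)) (bf_proj x)); lra.
- exists psi => [x|y]; apply/mdist_positivity/le_anti; rewrite mdist_ge0 andbT;
    apply/ler_addgt0Pr => e e0; rewrite add0r; have e4 : 0 < e / 4 by lra.
  + have [n [[/= xn yn] sn]] := filter_ex
      (filterI (filterI (hphi x _ e4) (hpsi (phi x) _ e4)) (small _ e4)).
    have := dis n _ _ _ _ (hg n (phi x)) (hf n x).
    by have := metric_triangle (psi (phi x)) (g n (phi x)) x; lra.
  + have [n [[/= xn yn] sn]] := filter_ex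
      (filterI (filterI (hpsi y _ e4) (hphi (psi y) _ e4)) (small _ e4)).
    have := dis n _ _ _ _ (hf n (psi y)) (hg n y).
    by have := metric_triangle (phi (psi y)) (f n (psi y)) y; lra.
Qed.

(** * Completeness *)

(** Totality of the relations extends a thread to the right of [n], surjectivity
    extends it to the left. Shifting the whole system in the induction keeps the
    dependent types aligned. *)
Lemma thread_through (X : nat -> Type) (rho : forall n, X n -> X n.+1 -> Prop) :
    (forall n x, exists y, rho n x y) -> (forall n y, exists x, rho n x y) ->
  forall n (x : X n), exists2 s : forall k, X k, forall k, rho k (s k) (s k.+1) & s n = x.
Proof.
move=> tot surj n; elim: n X rho tot surj => [|n IH] X rho tot surj x.
  pose next k (y : X k) := sval (cid (tot k y)).
  exists (fun k => nat_rect X x next k) => // k.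
  exact: svalP (cid (tot k _)).
have [s hs sn] := IH (fun k => X k.+1) (fun k => rho k.+1)
  (fun k => tot k.+1) (fun k => surj k.+1) x.
have [x0 hx0] := surj 0%N (s 0%N).
by exists (fun k => if k is k'.+1 then s k' else x0) => // -[|k]; [exact: hx0|exact: hs].
Qed.

(** The limit is the inverse limit of the [X n] along closed correspondences,
    with threads at distance zero identified. *)
Lemma gh_halving_limit (R : realType) (B : metricType R)
    (X : nat -> compact_bfield B) :
    complete_metric (@mdist R B) ->
    (forall n, (gh_dist (X n) (X n.+1) < (2^-1 ^+ n)%:E)%E) ->
  exists L : compact_bfield B, forall n, gh_close (2 * 2^-1 ^+ n) (X n) L.
Proof.
move=> Bc hX.
have rhoX n := cid2 (gh_dist_lt_correspondence (hX n)).
pose rho n : X n -> X n.+1 -> Prop := s2val (rhoX n).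
have rhoP n : correspondence (2^-1 ^+ n) (rho n) := s2valP (rhoX n).
have rho_closed n : forall x y, (forall e : R, 0 < e ->
    exists x' y', [/\ rho n x' y', mdist x x' < e & mdist y y' < e]) -> rho n x y
  := s2valP' (rhoX n).
pose T := {s : forall n, X n | forall n, rho n (s n) (s n.+1)}.
have through n (x : X n) : exists s : T, sval s n = x.
  have tot k : forall x, exists y, rho k x y by have [] := rhoP k.
  have surj k : forall y, exists x, rho k x y by have [] := rhoP k.
  have [s hs sx] := thread_through (X := fun n => bf_space (X n)) tot surj x.
  by exists (exist _ s hs).
(* Along a thread, distances change by at most [2 * 2 ^ -n] at step [n], hence by
   at most [4 * 2 ^ -n] from [n] on. *)
have /choice[D hD] (st : T * T) : exists D : R, forall n,
    `|mdist (sval st.1 n) (sval st.2 n) - D| <= 4 * 2^-1 ^+ n.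
  have two : (4 : R) = 2 * 2 by lra.
  rewrite two; apply: (complete_metric_geometric
    (d := fun x y : R => `|x - y|) (u := fun n => mdist (sval st.1 n) (sval st.2 n)))
    => // [|| n].
  - split=> [x y|x y|x y|x y z]; first exact: normr_ge0.
    + split=> [/eqP|->]; last by rewrite subrr normr0.
      by rewrite normr_eq0 subr_eq0 => /eqP.
    + exact: distrC.
    + exact: ler_distD.
  - exact: complete_metric_real.
  - have [_ _ dis _] := rhoP n.
    have := dis _ _ _ _ (svalP st.1 n) (svalP st.2 n).
    by rewrite ler_distl => -[h1 h2]; apply/andP; split; lra.
(* The constants 8 and 12 below count such comparisons of [D] with a coordinate,
   at [4 * 2 ^ -n] each; the projections contribute [2 * 2 ^ -n] each. *)
have DP s t n : D (s, t) <= mdist (sval s n) (sval t n) + 4 * 2^-1 ^+ n /\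
    mdist (sval s n) (sval t n) <= D (s, t) + 4 * 2^-1 ^+ n.
  by have := hD (s, t) n; rewrite ler_distl /= => /andP[h1 h2]; split; lra.
have /choice[f hf] (s : T) : exists b, forall n,
    mdist (bf_proj (sval s n)) b <= 2 * 1 * 2^-1 ^+ n.
  apply: (complete_metric_geometric (u := fun n => bf_proj (sval s n))) => // [|n].
    exact: mdist_is_metric.
  by have [_ _ _ disp] := rhoP n; rewrite mul1r; exact: disp (svalP s n).
have [x0 _] := bf_nonempty (X 0%N); have [s0 _] := through _ x0.
have [||||||Z [p [psurj pd pp]]] :=
  @quotient_bfield R B T (fun s t => D (s, t)) f.
- move=> s; apply/le_anti/andP; split;
    apply: (@le_half_pow _ 4) => // n; have := DP s s n; rewrite mdistxx; lra.
- move=> s t; apply/le_anti/andP; split;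
    apply: (@le_half_pow _ 8) => // n; have := DP s t n; have := DP t s n;
    by rewrite (metric_sym (sval t n)); lra.
- move=> s t u; apply: (@le_half_pow _ 12) => // n.
  have := DP s t n; have := DP t u n; have := DP s u n.
  by have := metric_triangle (sval s n) (sval t n) (sval u n); lra.
- by exists s0.
- move=> I U UU g.
  have a_ n := cid (compact_ultracompact (@cbf_compact _ _ (X n)) UU
    (fun i => sval (g i) n)).
  pose a n := sval (a_ n).
  have ha n e : 0 < e -> U [set i | mdist (a n) (sval (g i) n) < e] := svalP (a_ n) e.
  have aT n : rho n (a n) (a n.+1).
    apply: rho_closed => e e0.
    have [i [/= i1 i2]] := filter_ex (filterI (ha n e e0) (ha n.+1 e e0)).
    by exists (sval (g i) n), (sval (g i) n.+1); split=> //; exact: svalP (g i) n.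
  exists (exist _ a aT) => e e0; have e8 : 0 < e / 8 by lra.
  have [n hn] := half_pow_lt e8.
  apply: filterS (ha n _ e8) => i /=.
  have [/= Dn _] := DP (exist _ a aT) (g i) n => an.
  by apply: le_lt_trans Dn _; lra.
- move=> s t; apply: (@le_half_pow _ 8) => // n.
  have := DP s t n; have := hf s n; have := hf t n.
  have := bf_lipschitz (sval s n) (sval t n).
  have := metric_triangle (f s) (bf_proj (sval s n)) (f t).
  have := metric_triangle (bf_proj (sval s n)) (bf_proj (sval t n)) (f t).
  by rewrite (metric_sym (f s) (bf_proj (sval s n))); lra.
(* All threads in the class [z] count: the coordinate of a chosen representative
   of the class of a thread through [x] may differ from [x]. *)
exists Z => n; exists (fun x z => exists2 s, sval s n = x & p s = z); split.
- by move=> x; have [s sx] := through n x; exists (p s), s.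
- by move=> z; have [s sz] := psurj z; exists (sval s n), s.
- move=> _ _ _ _ [s <- <-] [t <- <-]; rewrite pd.
  by have := DP s t n; lra.
- by move=> _ _ [s <- <-]; rewrite pp; have := hf s n; rewrite mulr1.
Qed.

(** * Separability *)

(** The label of [X] encodes a finite [e]-net, through the labels of its
    projections to [B] and the integer parts of its distances divided by [e]. Points
    of [X] and [Y] are related when they are [e]-close to net points of the same
    index: the distortion is at most [4 * e] from the nets and [e] from the rounding,
    the displacement in [B] at most [2 * e] from the nets and [e] from the labels. *)
Lemma gh_code (R : realType) (B : metricType R) (e : R) :
    separable_metric (@mdist R B) -> 0 < e ->
  exists h : compact_bfield B -> nat, forall X Y, h X = h Y -> gh_close (3 * e) X Y.
Proof.
move=> Bs e0; have [b hb] := separable_metric_code (mdist_is_metric B) Bs e0.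
pose net (X : compact_bfield B) := sval (cid (compact_net (@cbf_compact _ _ X) e0)).
have netP (X : compact_bfield B) x : exists2 y, y \in net X & mdist x y < e.
  exact: svalP (cid (compact_net (@cbf_compact _ _ X) e0)) x.
pose dn (X : compact_bfield B) (x y : X) := Num.truncn (mdist x y / e).
pose code (X : compact_bfield B) : seq nat * seq (seq nat) :=
  ([seq b (bf_proj x) | x <- net X], [seq [seq dn X x y | y <- net X] | x <- net X]).
exists (pickle \o code) => X Y /(pcan_inj pickleK)[eb ed].
have [x0 _] := bf_nonempty X; have [y0 _] := bf_nonempty Y.
pose s := nth x0 (net X); pose t := nth y0 (net Y); pose N := size (net X).
have NY : size (net Y) = N by have := congr1 size eb; rewrite !size_map.
have projst i : (i < N)%N -> mdist (bf_proj (s i)) (bf_proj (t i)) < e.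
  move=> iN; apply: hb; have := congr1 (nth 0%N ^~ i) eb.
  by rewrite (nth_map x0)// (nth_map y0) ?NY.
have diststP i j : (i < N)%N -> (j < N)%N -> dn X (s i) (s j) = dn Y (t i) (t j).
  move=> iN jN; have := congr1 (fun l => nth 0%N (nth [::] l i) j) ed.
  by rewrite (nth_map x0)// (nth_map x0)// (nth_map y0) ?NY// (nth_map y0) ?NY.
have distst i j : (i < N)%N -> (j < N)%N ->
    mdist (s i) (s j) <= mdist (t i) (t j) + e /\
    mdist (t i) (t j) <= mdist (s i) (s j) + e.
  move=> iN jN; have := diststP i j iN jN; rewrite /dn => E.
  have /andP[] := truncn_itv (divr_ge0 (mdist_ge0 (s i) (s j)) (ltW e0)).
  have /andP[] := truncn_itv (divr_ge0 (mdist_ge0 (t i) (t j)) (ltW e0)).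
  rewrite -E !ler_pdivlMr// !ltr_pdivrMr// -natr1; lra.
exists (fun x y => exists i, [/\ (i < N)%N, mdist x (s i) < e & mdist y (t i) < e]).
split.
- move=> x; have [y yn xy] := netP X x.
  exists (t (index y (net X))), (index y (net X)).
  by rewrite /s nth_index// mdistxx index_mem.
- move=> y; have [x xn yx] := netP Y y.
  exists (s (index x (net Y))), (index x (net Y)).
  by rewrite /t nth_index// mdistxx -NY index_mem.
- move=> x x' y y' [i [iN xi yi]] [j [jN xj yj]].
  have := distst i j iN jN.
  have := metric_triangle x (s i) x'; have := metric_triangle (s i) (s j) x'.
  have := metric_triangle (s i) x (s j); have := metric_triangle x x' (s j).
  have := metric_triangle y (t i) y'; have := metric_triangle (t i) (t j) y'.
  have := metric_triangle (t i) y (t j); have := metric_triangle y y' (t j).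
  rewrite (metric_sym (s j) x') (metric_sym (s i) x).
  by rewrite (metric_sym (t j) y') (metric_sym (t i) y); lra.
- move=> x y [i [iN xi yi]]; have := projst i iN.
  have := bf_lipschitz x (s i); have := bf_lipschitz y (t i).
  have := metric_triangle (bf_proj x) (bf_proj (s i)) (bf_proj y).
  have := metric_triangle (bf_proj (s i)) (bf_proj (t i)) (bf_proj y).
  by rewrite (metric_sym (bf_proj (t i))); lra.
Qed.

(** * The space of isometry classes *)

Lemma isometric_class_repr (R : realType) (B : metricType R) (X : compact_bfield B) :
  isometric (class_repr (class_of X)) X.
Proof.
rewrite /class_repr; case: cid => Y /= e.
by rewrite -[isometric Y X]/((fun Z : compact_bfield B => isometric Y Z) X) -e;
  exact: isometric_refl.
Qed.

Lemma class_repr_inj (R : realType) (B : metricType R) (C D : isometry_class B) :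
  isometric (class_repr C) (class_repr D) -> C = D.
Proof.
rewrite /class_repr; case: cid => X eC; case: cid => Y eD /= XY.
case: C D eC eD => [C HC] [D HD] /= eC eD; apply: eq_exist; rewrite eC eD.
apply/funext => Z; apply/propext; split; last exact: isometric_trans XY.
exact: isometric_trans (isometric_sym XY).
Qed.

Lemma class_dist_class_of (R : realType) (B : metricType R) (X Y : compact_bfield B) :
  class_dist (class_of X) (class_of Y) = fine (gh_dist X Y).
Proof. exact: isometric_gh_dist (isometric_class_repr X) (isometric_class_repr Y). Qed.

Lemma class_dist_is_metric (R : realType) (B : metricType R) : is_metric (@class_dist R B).
Proof.
split=> [C D|C D|C D|C D E].
- exact/fine_ge0/gh_dist_ge0.
- split=> [CD|->]; last exact/gh_dist_isometric/isometric_refl.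
  apply/class_repr_inj/gh_close_all_isometric => e e0.
  by apply: gh_dist_lt; rewrite -/(class_dist C D) CD.
- exact: gh_dist_sym.
- exact: gh_dist_triangle.
Qed.

Lemma class_dist_complete (R : realType) (B : metricType R) :
  complete_metric (@mdist R B) -> complete_metric (@class_dist R B).
Proof.
move=> Bc; apply: (@complete_metric_halving _ _ _ 2) => // [|u hu].
  exact: class_dist_is_metric.
have [n|L hL] := @gh_halving_limit R B (fun n => class_repr (u n)) Bc.
  by rewrite -[gh_dist _ _]fineK ?gh_dist_fin_num// lte_fin; exact: hu.
exists (class_of L) => n; rewrite /class_dist.
rewrite (isometric_gh_dist (isometric_refl _) (isometric_class_repr L)).
exact: gh_dist_le.
Qed.

Lemma class_dist_separable (R : realType) (B : metricType R) :
  separable_metric (@mdist R B) -> separable_metric (@class_dist R B).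
Proof.
move=> Bs; apply: code_separable_metric => e e0; have e4 : 0 < e / 4 by lra.
have [h hh] := gh_code Bs e4; exists (fun C => h (class_repr C)) => C D CD.
by apply: le_lt_trans (gh_dist_le (hh _ _ CD)) _; lra.
Qed.

Theorem theorem2p12 (R : realType) (B : metricType R)
    (hB : polish_metric (@mdist R B)) :
  [/\ (* d_GH is finite on compact B-fields *)
      forall X Y : compact_bfield B, gh_dist X Y \is a fin_num,
      (* it depends only on the isometry classes *)
      forall X Y : compact_bfield B,
        class_dist (class_of X) (class_of Y) = fine (gh_dist X Y)
    & (* it is a complete separable metric on them *)
      polish_metric (@class_dist R B)].
Proof.
have [_ Bc Bs] := hB; split; first exact: gh_dist_fin_num.
  exact: class_dist_class_of.
split; first exact: class_dist_is_metric.
- exact: class_dist_complete.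
- exact: class_dist_separable.
Qed.
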